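(* Let $n\le m$ and $\overline{X}\in\mathbf{M}^{n\times m}$, and let $r=\mathrm{rank}\,\overline{X}$ and $\bar I:=\{(i,j):\overline{X}_{i,j}=0\}$. Let $\mathcal{G}$ be the bipartite graph on $n+m$ vertices ($n$ row vertices and $m$ column vertices) whose edge set is $\bar I^c$ (row vertex $i$ is joined to column vertex $j$ exactly when $\overline{X}_{i,j}\ne0$), and let $c(\mathcal{G})$ be the number of connected components of $\mathcal{G}$. Then there exists a $C^\infty$ manifold $\mathcal{M}$ of dimension $n+m-c(\mathcal{G})$ satisfying $$\overline{X}\in\mathcal{M}\subset\{X\in\mathbf{M}^{n\times m}:\mathrm{rank}\,X=r\ \text{ and }\ X_{i,j}=0\text{ for all }(i,j)\in\bar I\}.$$ Moreover, letting $\alpha$ be the number of nonzero rows of $\overline{X}$ and $\beta$ the number of nonzero columns of $\overline{X}$, there exists a linear subspace $\mathcal{V}$ of $\mathbf{M}^{n\times m}$ satisfying $$\overline{X}\in\mathcal{V}\subset\mathrm{cl}\,\mathcal{M}\subset\{X\in\mathbf{M}^{n\times m}:\mathrm{rank}\,X\le r\ \text{ and }\ X_{i,j}=0\text{ for all }(i,j)\in\bar I\}$$ and having $\dim\mathcal{V}\ge\max\{\alpha,\beta\}$.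
   Context: $\mathbf{M}^{n\times m}$ is the space of real $n\times m$ matrices; $\mathrm{cl}$ denotes topological closure. Manifolds are (embedded) smooth submanifolds of $\mathbf{M}^{n\times m}$. Isolated vertices of $\mathcal{G}$ count as connected components. *)

(* Defs.v *)
From mathcomp Require Export all_boot all_order all_algebra.
From mathcomp Require Export all_classical all_reals all_analysis.
Export Order.TTheory GRing.Theory Num.Theory.
Export numFieldNormedType.Exports.

Set Implicit Arguments.
Unset Strict Implicit.
Unset Printing Implicit Defensive.

Local Open Scope classical_set_scope.
Local Open Scope ring_scope.

(* The classical notion: all partial derivatives of order at most [k] exist
   and are continuous on the set [U], which is meant to be open.  The standard
   basis of the space of matrices consists of the matrices [delta_mx i j]. *)
Fixpoint Ck_on (R : realType) (p q s t : nat) (k : nat) (U : set 'M[R]_(p, q))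
    (f : 'M[R]_(p, q) -> 'M[R]_(s, t)) : Prop :=
  (forall x, U x -> {for x, continuous f}) /\
  match k with
  | 0%N => True
  | k'.+1 => forall (i : 'I_p) (j : 'I_q),
      (forall x, U x -> derivable f x (delta_mx i j)) /\
      Ck_on k' U (fun x => 'D_(delta_mx i j) f x)
  end.

Definition smooth_on (R : realType) (p q s t : nat) (U : set 'M[R]_(p, q))
    (f : 'M[R]_(p, q) -> 'M[R]_(s, t)) : Prop :=
  forall k : nat, Ck_on k U f.

(* [f] and [g] are arbitrary outside [U] and [W]. *)
Definition diffeomorphism (R : realType) (p q s t : nat)
    (U : set 'M[R]_(p, q)) (W : set 'M[R]_(s, t))
    (f : 'M[R]_(p, q) -> 'M[R]_(s, t)) (g : 'M[R]_(s, t) -> 'M[R]_(p, q))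
    : Prop :=
  [/\ open U /\ open W,
      smooth_on U f /\ smooth_on W g,
      forall x, U x -> W (f x) /\ g (f x) = x
    & forall y, W y -> U (g y) /\ f (g y) = y].

(* The subspace R^d x {0} of R^N. *)
Definition slice (R : realType) (N d : nat) : set 'rV[R]_N :=
  [set y | forall k : 'I_N, (d <= k)%N -> y 0 k = 0].

(* Embedded smooth submanifolds, through smooth slice charts.  The bound on [d]
   is needed because [@slice R N d] is all of R^N as soon as [N <= d]. *)
Definition embedded_submanifold (R : realType) (p q d : nat)
    (M : set 'M[R]_(p, q)) : Prop :=
  (d <= p * q)%N /\
  forall X, M X ->
    exists (U : set 'M[R]_(p, q)) (W : set 'rV[R]_(p * q))
           (phi : 'M[R]_(p, q) -> 'rV[R]_(p * q))
           (psi : 'rV[R]_(p * q) -> 'M[R]_(p, q)),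
      [/\ U X, diffeomorphism U W phi psi
        & phi @` (U `&` M) = W `&` @slice R (p * q) d].

Definition zero_entries (R : realType) (n m : nat) (X : 'M[R]_(n, m))
    : {set 'I_n * 'I_m} :=
  [set p : 'I_n * 'I_m | X p.1 p.2 == 0]%SET.

Definition bipartite_rel (n m : nat) (E : {set 'I_n * 'I_m})
    : rel ('I_n + 'I_m) :=
  fun u v =>
    match u, v with
    | inl i, inr j | inr j, inl i => (i, j) \in E
    | _, _ => false
    end.

Lemma bipartite_rel_sym (n m : nat) (E : {set 'I_n * 'I_m}) :
  symmetric (bipartite_rel E).
Proof. by case=> [i|j] [i'|j']. Qed.

Definition num_components (n m : nat) (E : {set 'I_n * 'I_m}) : nat :=
  n_comp (bipartite_rel E) predT.

Definition num_nonzero_rows (R : realType) (n m : nat) (X : 'M[R]_(n, m))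
    : nat :=
  #|[pred i : 'I_n | row i X != 0]|.

Definition num_nonzero_cols (R : realType) (n m : nat) (X : 'M[R]_(n, m))
    : nat :=
  #|[pred j : 'I_m | col j X != 0]|.

(* Main.v *)
(** [M] is the orbit of [Xbar] under rescaling rows and columns by nonzero
    scalars, so rank and zero pattern are constant on it.  Let [F] be a spanning
    forest of the bipartite graph of nonzero entries; it has
    [n + m - c] edges.  An element of the orbit has nonzero entries on [F], these
    can be prescribed arbitrarily, and they determine the row and column scalars
    up to a constant per component, hence every other entry as a
    Laurent monomial in the entries on [F].  So [M] is the graph of a smooth
    function.  Letting some row scalars (or some column scalars) tend to [0]
    shows that the closure of [M] contains the linear space of all row (or
    column) rescalings of [Xbar]. *)

Require Import Defs.
From mathcomp Require Import perm.

Set Implicit Arguments.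
Unset Strict Implicit.
Unset Printing Implicit Defensive.

Local Open Scope classical_set_scope.
Local Open Scope ring_scope.

(** * Spanning forests *)

(** Induction on a path: one crossing of the new edge suffices, since a second crossing leads back
    to an end of it visited before. *)
Lemma connect_add_edge (T : finType) (e : rel T) (x y u v : T) :
  connect [rel a b | [|| e a b, (a == x) && (b == y) | (a == y) && (b == x)]] u v
  = [|| connect e u v, connect e u x && connect e y v
      | connect e u y && connect e x v].
Proof.
set e' := [rel a b | _].
have sub_e : subrel (connect e) (connect e').
  by apply: connect_sub => a b eab; apply: connect1; rewrite /= eab.
apply/idP/idP => [/connectP[p]|].
  elim: p u => [|w p IH] u /= => [_ ->|]; first by rewrite connect0.
  case/andP=> euw /IH{}IH /IH{IH}; case/or3P: euw => [euw|/andP[/eqP-> /eqP->]|/andP[/eqP-> /eqP->]].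
  - have cuw := connect1 euw.
    case/or3P=> [|/andP[c1 c2]|/andP[c1 c2]].
    + by move/(connect_trans cuw)->.
    + by rewrite (connect_trans cuw c1) c2 orbT.
    + by rewrite (connect_trans cuw c1) c2 !orbT.
  - by rewrite !connect0 /=; case/or3P=> [->|/andP[_ ->]|->]; rewrite ?orbT.
  - by rewrite !connect0 /=; case/or3P=> [->|->|/andP[_ ->]]; rewrite ?orbT.
case/or3P=> [/sub_e//|/andP[/sub_e c1 /sub_e c2]|/andP[/sub_e c1 /sub_e c2]].
- apply: (connect_trans c1 (connect_trans (connect1 _) c2)).
  by rewrite /= !eqxx orbT.
- apply: (connect_trans c1 (connect_trans (connect1 _) c2)).
  by rewrite /= !eqxx !orbT.
Qed.

(** The component of [y] merges into that of [x]; [root e'] maps the remaining roots of [e]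
    bijectively onto the roots of [e']. *)
Lemma n_comp_add_edge (T : finType) (e e' : rel T) (x y : T) :
  symmetric e ->
  e' =2 [rel a b | [|| e a b, (a == x) && (b == y) | (a == y) && (b == x)]] ->
  ~~ connect e x y ->
  n_comp e predT = (n_comp e' predT).+1.
Proof.
move=> e_sym e'E nxy; have cS := sym_connect_sym e_sym.
have e'_sym : symmetric e'.
  move=> a b; rewrite !e'E /= e_sym; congr (_ || _).
  by rewrite orbC; congr (_ || _); rewrite andbC.
have c'S := sym_connect_sym e'_sym.
have c'E u v : connect e' u v = [|| connect e u v, connect e u x && connect e y v
      | connect e u y && connect e x v].
  by rewrite (eq_connect e'E) connect_add_edge.
rewrite /n_comp_mem (cardD1 (fingraph.root e y)) !inE (roots_root cS) add1n; congr _.+1.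
have inj : {in [predD1 predI (roots e) (mem predT) & fingraph.root e y] &, injective (fingraph.root e')}.
  move=> u v; rewrite !inE /= !andbT => /andP[uy /eqP ru] /andP[vy /eqP rv].
  move/eqP; rewrite (root_connect c'S) c'E.
  case/or3P=> [|/andP[_ cyv]|/andP[cuy _]].
  - by rewrite -(root_connect cS) ru rv => /eqP.
  - by case/negP: vy; rewrite -rv (root_connect cS) cS.
  - by case/negP: uy; rewrite -ru (root_connect cS).
rewrite -(card_in_image inj); apply: eq_card => z; transitivity (roots e' z); last by rewrite !inE /= andbT.
apply/fintype.imageP/idP => [[u _ ->]|/eqP rz]; first exact: roots_root.
have [zy|zy] := boolP (connect e z y).
  exists (fingraph.root e x); first by rewrite !inE /= (roots_root cS) (root_connect cS) nxy.
  rewrite -rz; apply/eqP; rewrite (root_connect c'S) c'E zy.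
  by rewrite connect_root !orbT.
exists (fingraph.root e z); first by rewrite !inE /= (roots_root cS) (root_connect cS) zy.
by rewrite -[LHS]rz; apply/eqP; rewrite (root_connect c'S) c'E connect_root.
Qed.

Lemma n_comp_no_edge (T : finType) (e : rel T) :
  (forall x y, e x y = false) -> n_comp e predT = #|T|.
Proof.
move=> e0; apply: eq_card => x; rewrite !inE /= andbT.
have /connectP[[|y p] /=] := connect_root e x; last by rewrite e0.
by move=> _; rewrite /roots => /eqP.
Qed.

(* No cycles: every edge is a bridge. *)
Definition forest (n m : nat) (F : {set 'I_n * 'I_m}) : Prop :=
  forall i j, (i, j) \in F ->
    ~~ connect (bipartite_rel (F :\ (i, j))%SET) (inl i) (inr j).

Lemma connect_bipartite_sub (n m : nat) (F G : {set 'I_n * 'I_m}) :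
  F \subset G ->
  subrel (connect (bipartite_rel F)) (connect (bipartite_rel G)).
Proof.
move=> /fintype.subsetP FG; apply: connect_sub => u v uv; apply: connect1.
by move: u v uv => [i|j] [i'|j'] //= /FG.
Qed.

(** Every edge of a forest is a bridge, so deleting one edge, which leaves a forest, adds exactly
    one component. *)
Lemma forest_num_components (n m : nat) (F : {set 'I_n * 'I_m}) :
  forest F -> (num_components F + #|F|)%N = (n + m)%N.
Proof.
move: {2}#|F| (leqnn #|F|) => k; elim: k F => [|k IH] F.
  rewrite leqn0 cards_eq0 => /eqP-> _; rewrite cards0 addn0 /num_components.
  by rewrite n_comp_no_edge ?card_sum ?card_ord // => -[i|j] [i'|j'] //=; rewrite inE.
have [->|[[i j] Fij] leF fF] := set_0Vmem F.
  by move=> _; apply: IH; rewrite cards0.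
have cF : #|F| = #|(F :\ (i, j))%SET|.+1 by rewrite (cardsD1 (i, j)) Fij.
rewrite -(IH (F :\ (i, j))%SET); first last.
- move=> i' j'; rewrite !inE => /andP[_ F']; apply: contra (fF _ _ F').
  by apply: connect_bipartite_sub; apply/finset.setSD/finset.subD1set.
- by rewrite -ltnS -cF.
rewrite cF addnS -addSn; congr (_ + _)%N; apply/esym.
apply: (@n_comp_add_edge _ _ _ (inl i) (inr j)); last exact: fF.
  exact: bipartite_rel_sym.
have inlE (a b : 'I_n) : (inl a == inl b :> 'I_n + 'I_m) = (a == b) by [].
have inrE (a b : 'I_m) : (inr a == inr b :> 'I_n + 'I_m) = (a == b) by [].
case=> [a|b] [a'|b'] /=; rewrite ?inE ?inlE ?inrE ?andbF ?orbF //=.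
  have [[-> ->]|] := altP ((a, b') =P (i, j)); first by rewrite Fij !eqxx.
  by rewrite xpair_eqE => /negbTE->; rewrite orbF.
have [[-> ->]|] := altP ((a', b) =P (i, j)); first by rewrite Fij !eqxx.
by rewrite xpair_eqE andbC => /negbTE->; rewrite orbF.
Qed.

(** [F] is chosen as an inclusion-minimal subset of [E] that preserves connectivity. *)
Lemma spanning_forest (n m : nat) (E : {set 'I_n * 'I_m}) :
  exists F : {set 'I_n * 'I_m},
    [/\ F \subset E, forest F
      & connect (bipartite_rel F) =2 connect (bipartite_rel E)].
Proof.
pose P (F : {set 'I_n * 'I_m}) := (F \subset E) &&
  [forall u, forall v, connect (bipartite_rel E) u v ==> connect (bipartite_rel F) u v].
have PE : P E.
  by rewrite /P subxx; apply/forallP => u; apply/forallP => v; apply/implyP.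
have [F /minsetP[/andP[FE /forallP cF] minF] _] := minset_exists PE.
have {}cF u v : connect (bipartite_rel E) u v -> connect (bipartite_rel F) u v.
  by apply/implyP; apply: (forallP (cF u)).
exists F; split=> //; last first.
  move=> u v; apply/idP/idP; [exact: connect_bipartite_sub | exact: cF].
move=> i j Fij; apply/negP => cij.
(* If [i] and [j] remained connected without the edge, a smaller set would still satisfy [P]. *)
have /minF/(_ (finset.subD1set _ _)) /setP/(_ (i, j)) : P (F :\ (i, j))%SET.
  rewrite /P (fintype.subset_trans (finset.subD1set _ _) FE) /=.
  apply/forallP => u; apply/forallP => v; apply/implyP => /cF.
  apply: connect_sub u v => u v.
  have cji : connect (bipartite_rel (F :\ (i, j))%SET) (inr j) (inl i).
    by rewrite (sym_connect_sym (@bipartite_rel_sym _ _ _)).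
  move: u v => [a|b] [a'|b'] //= Fab.
    have [[-> ->]//|ne] := altP ((a, b') =P (i, j)).
    by apply: connect1; rewrite /= !inE ne.
  have [[-> ->]//|ne] := altP ((a', b) =P (i, j)).
  by apply: connect1; rewrite /= !inE ne.
by rewrite !inE eqxx Fij.
Qed.
(** * Smooth functions *)

Lemma continuous_mx (R : realType) (T : topologicalType) (s t : nat)
    (f : T -> 'M[R]_(s, t)) (x : T) :
  (forall i j, {for x, continuous (fun y => f y i j)}) ->
  {for x, continuous f}.
Proof.
move=> fc; apply/cvgrPdist_le => /= e e0; near=> y.
rewrite [leLHS]/Num.Def.normr/= mx_normrE (bigmax_le _ (ltW e0))//= => i _.
rewrite !mxE; move: i; near: y; apply: filter_forall => /= i.
by move/cvgrPdist_le : (fc i.1 i.2); apply.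
Unshelve. all: by end_near. Qed.

(* Only the values on [U] of the partial derivatives matter, which makes the
   class stable under operations without changing functions outside [U]. *)
Fixpoint Ck_scalar (R : realType) (p q k : nat) (U : set 'M[R]_(p, q))
    (f : 'M[R]_(p, q) -> R) : Prop :=
  (forall x, U x -> {for x, continuous f}) /\
  if k is k'.+1 then
    forall i j, exists2 g, forall x, U x -> is_derive x (delta_mx i j) f (g x)
                         & Ck_scalar k' U g
  else True.

Section Ck_scalar_theory.
Context (R : realType) (p q : nat) (U : set 'M[R]_(p, q)).
Implicit Types (f g : 'M[R]_(p, q) -> R) (k : nat).

Lemma Ck_scalarW k f : Ck_scalar k.+1 U f -> Ck_scalar k U f.
Proof.
elim: k f => [|k IH] f [fc fd]; split=> // i j.
by have [g dg /IH Cg] := fd i j; exists g.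
Qed.

Lemma Ck_scalar_continuous k f x :
  Ck_scalar k U f -> U x -> {for x, continuous f}.
Proof. by case: k => [|k] [fc _]; apply: fc. Qed.

Lemma Ck_scalar_cst k (c : R) : Ck_scalar k U (fun=> c).
Proof.
elim: k c => [|k IH] c; split=> //; try by move=> x _; exact: cst_continuous.
by move=> i j; exists (fun=> 0) => // x _; apply: is_derive_cst.
Qed.

Lemma is_derive_coord (i : 'I_p) (j : 'I_q) (x v : 'M[R]_(p, q)) :
  is_derive x v (fun y : 'M[R]_(p, q) => y i j : R) (v i j).
Proof.
have did := @derivable_id _ _ x v.
split; first exact: (derivable_mxP id x v).1.
by rewrite -[in RHS](derive_id x v) derive_mx // mxE.
Qed.

Lemma Ck_scalar_coord k (i : 'I_p) (j : 'I_q) :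
  Ck_scalar k U (fun y : 'M[R]_(p, q) => y i j).
Proof.
case: k => [|k]; split=> //; try by move=> x _; exact: coord_continuous.
move=> i' j'; exists (fun=> delta_mx i' j' i j); last exact: Ck_scalar_cst.
by move=> x _; apply: is_derive_coord.
Qed.

Lemma Ck_scalarD k f g :
  Ck_scalar k U f -> Ck_scalar k U g -> Ck_scalar k U (fun x => f x + g x).
Proof.
elim: k f g => [|k IH] f g Cf Cg.
  by split=> // x Ux; apply: continuousD;
  [exact: Ck_scalar_continuous Cf Ux | exact: Ck_scalar_continuous Cg Ux].
split; first by move=> x Ux; apply: continuousD;
  [exact: Ck_scalar_continuous Cf Ux | exact: Ck_scalar_continuous Cg Ux].
move=> i j; case: Cf Cg => _ /(_ i j)[f' df Cf'] [_ /(_ i j)[g' dg Cg']].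
exists (fun x => f' x + g' x); last exact: IH.
by move=> x Ux; have := df x Ux; have := dg x Ux => ? ?; apply: is_deriveD.
Qed.

Lemma Ck_scalarM k f g :
  Ck_scalar k U f -> Ck_scalar k U g -> Ck_scalar k U (fun x => f x * g x).
Proof.
elim: k f g => [|k IH] f g Cf Cg.
  by split=> // x Ux; apply: continuousM;
  [exact: Ck_scalar_continuous Cf Ux | exact: Ck_scalar_continuous Cg Ux].
split; first by move=> x Ux; apply: continuousM;
  [exact: Ck_scalar_continuous Cf Ux | exact: Ck_scalar_continuous Cg Ux].
(* The product rule involves [f] and [g] themselves, so both are also needed at order [k]. *)
move=> i j; have [Cf0 Cg0] := (Ck_scalarW Cf, Ck_scalarW Cg).
case: Cf Cg => _ /(_ i j)[f' df Cf'] [_ /(_ i j)[g' dg Cg']].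
exists (fun x => f x * g' x + g x * f' x).
  by move=> x Ux; have := df x Ux; have := dg x Ux => ? ?; apply: is_deriveM.
by apply: Ck_scalarD; apply: IH.
Qed.

Lemma Ck_scalarN k f : Ck_scalar k U f -> Ck_scalar k U (fun x => - f x).
Proof.
rewrite (_ : (fun x => - f x) = (fun x => (-1) * f x)).
  by apply: Ck_scalarM; apply: Ck_scalar_cst.
by apply: funext => x; rewrite mulN1r.
Qed.

Lemma Ck_scalarV k f :
  (forall x, U x -> f x != 0) -> Ck_scalar k U f ->
  Ck_scalar k U (fun x => (f x)^-1).
Proof.
move=> f0.
have cV k' : Ck_scalar k' U f -> forall x, U x -> {for x, continuous (fun x => (f x)^-1)}.
  by move=> Cf x Ux; apply: continuousV; [exact: f0|exact: Ck_scalar_continuous Cf Ux].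
elim: k => [|k IH] Cf; first by split=> //; exact: cV Cf.
split; first exact: cV Cf.
move=> i j; have CV := IH (Ck_scalarW Cf).
case: Cf => _ /(_ i j)[f' df Cf'].
(* Written with factors [(f x)^-1], so that the induction hypothesis for the inverse at order [k]
   applies. *)
exists (fun x => - ((f x)^-1 * (f x)^-1) * f' x); last first.
  by do 2![apply: Ck_scalarM => //; try apply: Ck_scalarN]; exact: Ck_scalarM.
move=> x Ux; have := df x Ux => -[dx <-]; split; first by apply: derivableV => //; exact: f0.
by rewrite deriveV ?f0 // expr2 invfM.
Qed.

Lemma Ck_scalar_prod k (I : Type) (r : seq I) (P : pred I)
    (F : I -> 'M[R]_(p, q) -> R) :
  (forall i, P i -> Ck_scalar k U (F i)) ->
  Ck_scalar k U (fun x => \prod_(i <- r | P i) F i x).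
Proof.
move=> CF; elim: r => [|i r IH].
  have -> : (fun x => \prod_(i <- [::] | P i) F i x) = fun=> 1.
    by apply: funext => x; rewrite big_nil.
  exact: Ck_scalar_cst.
have -> : (fun x => \prod_(i <- i :: r | P i) F i x) =
    fun x => (if P i then F i x else 1) * \prod_(j <- r | P j) F j x.
  by apply: funext => x; rewrite big_cons; case: ifP; rewrite ?mul1r.
by apply: Ck_scalarM => //; case: (P i) (CF i) => [/(_ isT)//|_]; exact: Ck_scalar_cst.
Qed.

Lemma Ck_scalar_sum k (I : Type) (r : seq I) (F : I -> 'M[R]_(p, q) -> R) :
  (forall i, Ck_scalar k U (F i)) ->
  Ck_scalar k U (fun x => \sum_(i <- r) F i x).
Proof.
move=> CF; elim: r => [|i r IH].
  have -> : (fun x => \sum_(i <- [::]) F i x) = fun=> 0.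
    by apply: funext => x; rewrite big_nil.
  exact: Ck_scalar_cst.
have -> : (fun x => \sum_(j <- i :: r) F j x) =
    fun x => F i x + \sum_(j <- r) F j x.
  by apply: funext => x; rewrite big_cons.
exact: Ck_scalarD.
Qed.

(** On an open set, agreement is agreement near each point, so continuity and derivatives carry
    over; the witnesses for the partial derivatives of [f] serve for [g]. *)
Lemma Ck_scalar_eq k f g : open U -> (forall x, U x -> f x = g x) ->
  Ck_scalar k U f -> Ck_scalar k U g.
Proof.
move=> oU fg.
have near_fg x : U x -> \near x, f x = g x.
  by move=> Ux; apply: filterS (open_nbhs_nbhs (conj oU Ux)).
have fgc x : U x -> {for x, continuous f} -> {for x, continuous g}.
  move=> Ux; rewrite /prop_for /continuous_at -fg //.
  by apply: cvg_trans; apply: (@near_eq_cvg _ _ (nbhs x) _ f g); exact: near_fg.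
case: k => [|k] [fc fd]; split=> //; try by move=> x Ux; apply: fgc => //; exact: fc.
move=> i j; have [f' df Cf'] := fd i j; exists f' => // x Ux.
by have := df x Ux; apply: near_eq_is_derive; exact: near_fg.
Qed.

(** Reduces smoothness of matrix maps to their entries. The actual partial derivatives are known to
    agree with the witnesses only on [U], hence the passage through [Ck_scalar_eq]. *)
Lemma Ck_onP (s t : nat) k (f : 'M[R]_(p, q) -> 'M[R]_(s, t)) :
  open U -> (forall i j, Ck_scalar k U (fun x => f x i j)) -> Ck_on k U f.
Proof.
move=> oU; elim: k f => [|k IH] f Cf /=.
  split=> // x Ux; apply: continuous_mx => i j; exact: Ck_scalar_continuous (Cf i j) Ux.
split.
  by move=> x Ux; apply: continuous_mx => i j; exact: Ck_scalar_continuous (Cf i j) Ux.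
move=> i j.
have df x : U x -> derivable f x (delta_mx i j).
  move=> Ux; apply/derivable_mxP => i' j'.
  by have [_ /(_ i j)[g dg _]] := Cf i' j'; have [] := dg x Ux.
split=> //; apply: IH => i' j'.
have [_ /(_ i j)[g dg]] := Cf i' j'; apply: Ck_scalar_eq => // x Ux.
by rewrite derive_mx ?mxE; [have [_ ->] := dg x Ux | exact: df].
Qed.

End Ck_scalar_theory.
(** * Torus orbits *)

(** Listing [F] before its complement makes the slice of dimension [#|F|] the set where the
    coordinates outside [F] vanish. *)
Lemma initial_enumeration (T : finType) (N : nat) (F : {set T}) :
  #|T| = N ->
  exists (s : T -> 'I_N) (s' : 'I_N -> T),
    [/\ cancel s s', cancel s' s & forall e, (s e < #|F|)%N = (e \in F)].
Proof.
move=> cT; pose l := enum F ++ enum (~: F)%SET.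
have meml e : e \in l by rewrite mem_cat !mem_enum inE orbN.
have szl : size l = N by rewrite size_cat -!cardE cardsC.
have lt_l e : (index e l < N)%N by rewrite -szl index_mem.
pose s e := Ordinal (lt_l e).
have s_inj : injective s.
  by move=> e1 e2 /(congr1 val) /= /(congr1 (nth e1 l)); rewrite !nth_index.
have [|s' sK s'K] := inj_card_bij s_inj; first by rewrite card_ord cT.
exists s, s'; split=> // e; rewrite /= index_cat mem_enum cardE.
by case: ifP => [Fe|_]; [rewrite index_mem mem_enum | rewrite ltnNge leq_addr].
Qed.

(** The index maps [r] and [c] cover both matrices and the row vectors of a chart. *)
Lemma open_entries_neq0 (R : realType) (p q : nat) (I : finType) (F : {set I})
    (r : I -> 'I_p) (c : I -> 'I_q) :
  open [set y : 'M[R]_(p, q) | forall e, e \in F -> y (r e) (c e) != 0].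
Proof.
rewrite openE => y Uy.
suff: nbhs y [set z : 'M[R]_(p, q) | forall e, e \in F -> z (r e) (c e) != 0] by [].
apply: (@filter_forall _ _
  (fun e (z : 'M[R]_(p, q)) => e \in F -> z (r e) (c e) != 0) (nbhs y) _) => e.
have [Fe|nFe] := boolP (e \in F); last exact: filterE.
have ye : nbhs y [set z : 'M[R]_(p, q) | z (r e) (c e) != 0] :=
  @coord_continuous R p q (r e) (c e) y _
    (open_nbhs_nbhs (conj (@open_neq R 0) (Uy e Fe))).
by apply: filterS ye => z zP _.
Qed.

(* A set that is globally the graph of a smooth function [h] of the entries
   indexed by [F]: subtracting [h] from the other entries straightens it. *)
Lemma graph_embedded_submanifold (R : realType) (n m : nat)
    (F : {set 'I_n * 'I_m})
    (h : ('I_n * 'I_m -> R) -> 'I_n * 'I_m -> R) :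
  (forall x x', {in F, x =1 x'} -> h x =1 h x') ->
  (forall (p q k : nat) (U : set 'M[R]_(p, q))
      (g : 'M[R]_(p, q) -> 'I_n * 'I_m -> R),
     (forall e, Ck_scalar k U (g^~ e)) ->
     (forall y e, U y -> e \in F -> g y e != 0) ->
     forall e, Ck_scalar k U (fun y => h (g y) e)) ->
  embedded_submanifold #|F|
    [set X : 'M[R]_(n, m) | (forall e, e \in F -> X e.1 e.2 != 0) /\
       (forall e, e \notin F -> X e.1 e.2 = h (fun f => X f.1 f.2) e)].
Proof.
move=> h_ext h_smooth.
have cIJ : #|{: 'I_n * 'I_m}| = (n * m)%N by rewrite card_prod !card_ord.
split; first by rewrite -cIJ max_card.
move=> X0 [X0F _].
have [s [s' [sK s'K sF]]] := initial_enumeration F cIJ.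
pose ent (X : 'M[R]_(n, m)) (e : 'I_n * 'I_m) := X e.1 e.2.
pose coo (y : 'rV[R]_(n * m)) e := y 0 (s e).
(* The correction is zero on [F] and depends only on the entries there, so subtracting it and adding
   it are mutually inverse. *)
pose corr (x : 'I_n * 'I_m -> R) e := if e \in F then 0 else h x e.
have corr_ext x x' : {in F, x =1 x'} -> corr x =1 corr x'.
  by move=> xx' e; rewrite /corr (h_ext x x').
pose phi X : 'rV[R]_(n * m) := \row_k (ent X (s' k) - corr (ent X) (s' k)).
pose psi y : 'M[R]_(n, m) := \matrix_(i, j) (coo y (i, j) + corr (coo y) (i, j)).
(* [U] and [W] do not depend on [X0]: one chart covers the whole set. *)
pose U := [set X : 'M[R]_(n, m) | forall e, e \in F -> X e.1 e.2 != 0].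
pose W := [set y : 'rV[R]_(n * m) | forall e, e \in F -> y 0 (s e) != 0].
have cooE X e : coo (phi X) e = ent X e - corr (ent X) e.
  by rewrite /coo mxE sK.
have entE y e : ent (psi y) e = coo y e + corr (coo y) e.
  by rewrite /ent mxE; case: e.
have cooF X : {in F, coo (phi X) =1 ent X}.
  by move=> e Fe; rewrite cooE /corr Fe subr0.
have entF y : {in F, ent (psi y) =1 coo y}.
  by move=> e Fe; rewrite entE /corr Fe addr0.
have phiK X : psi (phi X) = X.
  apply/matrixP => i j; rewrite -[LHS]/(ent _ (i, j)) entE cooE.
  by rewrite (corr_ext _ _ (cooF X)) subrK.
have psiK y : phi (psi y) = y.
  apply/rowP => k; rewrite -[k]s'K -[LHS]/(coo _ (s' k)) cooE entE.
  by rewrite (corr_ext _ _ (entF y)) addrK.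
have phiW X : U X -> W (phi X).
  by move=> UX e Fe; rewrite -/(coo _ e) cooF //; exact: UX.
have psiU y : W y -> U (psi y).
  by move=> Wy e Fe; rewrite -/(ent _ e) entF //; exact: Wy.
have corr_smooth (p q k : nat) (V : set 'M[R]_(p, q)) g e :
    (forall e, Ck_scalar k V (g^~ e)) ->
    (forall y e, V y -> e \in F -> g y e != 0) ->
    Ck_scalar k V (fun y => corr (g y) e).
  rewrite /corr; case: (e \in F); first by move=> *; exact: Ck_scalar_cst.
  by move=> Cg g0; exact: h_smooth.
have oU : open U by exact: (@open_entries_neq0 R n m _ F fst snd).
have oW : open W by exact: (@open_entries_neq0 R 1 (n * m) _ F (fun=> 0) s).
exists U, W, phi, psi; split=> //.
  split=> //; [split=> k; apply: Ck_onP => // i j | by move=> X /phiW | by move=> y /psiU].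
    apply: (@Ck_scalar_eq _ _ _ _ _ (fun X => ent X (s' j) + - corr (ent X) (s' j))) => //.
      by move=> X _; rewrite mxE.
    have Cent e : Ck_scalar k U (fun X => ent X e).
      exact: (@Ck_scalar_coord R n m U k e.1 e.2).
    apply: Ck_scalarD => //; apply: Ck_scalarN.
    by apply: (corr_smooth _ _ _ _ ent) => // X e UX; exact: UX.
  have Ccoo e : Ck_scalar k W (fun y => coo y e).
    exact: (@Ck_scalar_coord R 1 (n * m) W k 0 (s e)).
  apply: (@Ck_scalar_eq _ _ _ _ _ (fun y => coo y (i, j) + corr (coo y) (i, j))) => //.
    by move=> y _; rewrite mxE.
  apply: Ck_scalarD => //.
  by apply: (corr_smooth _ _ _ _ coo) => // y e Wy; exact: Wy.
(* On the graph the corrected entries outside [F] vanish; conversely, their vanishing puts [psi y]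
   on the graph. *)
apply/seteqP; split=> [_ [X [UX [_ XM]] <-]|y [Wy ys]].
  split; first exact: phiW.
  move=> k le_k; rewrite mxE /corr.
  have nF : s' k \notin F by rewrite -sF s'K -leqNgt.
  by rewrite (negbTE nF) /ent -XM // subrr.
exists (psi y) => //; split; first exact: psiU.
split; first exact: psiU.
move=> e nF; rewrite -/(ent _ e) -/(ent _) entE /corr (negbTE nF).
by rewrite (h_ext _ _ (entF y)) /coo ys ?add0r // leqNgt sF.
Qed.

(** * Potentials on a forest *)

Section ForestPotential.
Context (R : realType) (n m : nat) (Y : 'M[R]_(n, m)) (F : {set 'I_n * 'I_m}).
Hypothesis YF : forall f, f \in F -> Y f.1 f.2 != 0.
Implicit Types (x : 'I_n * 'I_m -> R) (v : 'I_n + 'I_m).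

(* The solution [w] of [w (inl i) / w (inr j) = x (i, j) / Y i j] on the edges
   of the forest: deleting the edge [f] from [F] splits a tree, and
   crossing [f] multiplies [w] by [x f / Y f]. *)
Definition forest_potential x v : R :=
  \prod_(f in F | connect (bipartite_rel (F :\ f)%SET) (inl f.1) v)
    (x f / Y f.1 f.2).

(** For a spanning forest, the entry at [e] of the orbit element with entries [x] on [F]: a multiple
    of a Laurent monomial in [x]. *)
Definition forest_extension x (e : 'I_n * 'I_m) : R :=
  Y e.1 e.2 *
    (forest_potential x (inl e.1) / forest_potential x (inr e.2)).

Lemma forest_potential_neq0 x v :
  (forall f, f \in F -> x f != 0) -> forest_potential x v != 0.
Proof.
move=> x0; apply/prodf_neq0 => f /andP[Ff _].
by rewrite mulf_neq0 ?invr_eq0 ?x0 ?YF.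
Qed.

(** The factor of [(i, j)] occurs for [inl i] but not for [inr j], as that edge is a bridge;
    deleting any other edge leaves [i] and [j] joined, so the other factors coincide. *)
Lemma forest_potential_edge x i j : forest F -> (i, j) \in F ->
  forest_potential x (inl i) = x (i, j) / Y i j * forest_potential x (inr j).
Proof.
move=> fF Fij; rewrite /forest_potential (bigD1 (i, j)) /=; last first.
  by rewrite Fij connect0.
congr (_ * _); apply: eq_bigl => f; have [->|fij] /= := eqVneq f (i, j).
  by rewrite andbF Fij (negbTE (fF _ _ Fij)).
rewrite andbT; congr (_ && _).
have cS := sym_connect_sym (@bipartite_rel_sym _ _ (F :\ f)%SET).
apply: (same_connect_r cS); apply: connect1.
by rewrite /= !inE eq_sym fij.
Qed.

Lemma forest_extension_in x e : forest F ->
  (forall f, f \in F -> x f != 0) -> e \in F -> forest_extension x e = x e.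
Proof.
case: e => i j fF x0 Fij; rewrite /forest_extension (forest_potential_edge _ fF Fij) /=.
by rewrite mulfK ?forest_potential_neq0 // mulrC divfK // (YF Fij).
Qed.

Lemma eq_forest_extension x x' :
  {in F, x =1 x'} -> forest_extension x =1 forest_extension x'.
Proof.
move=> xx' e; have E v : forest_potential x v = forest_potential x' v.
  by apply: eq_bigr => f /andP[/xx' ->].
by rewrite /forest_extension !E.
Qed.

Lemma forest_extension_smooth (p q k : nat) (U : set 'M[R]_(p, q))
    (g : 'M[R]_(p, q) -> 'I_n * 'I_m -> R) :
  (forall e, Ck_scalar k U (g^~ e)) ->
  (forall y e, U y -> e \in F -> g y e != 0) ->
  forall e, Ck_scalar k U (fun y => forest_extension (g y) e).
Proof.
move=> Cg g0 e.
have Cw v : Ck_scalar k U (fun y => forest_potential (g y) v).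
  apply: Ck_scalar_prod => f _; apply: Ck_scalarM => //; exact: Ck_scalar_cst.
apply: Ck_scalarM; first exact: Ck_scalar_cst.
apply: Ck_scalarM => //; apply: Ck_scalarV => // y Uy.
by apply: forest_potential_neq0 => f; exact: g0.
Qed.

End ForestPotential.

(** The quotient [w / u] takes equal values at the ends of each edge, hence is constant on
    components. *)
Lemma potential_ratio_connect (R : realType) (n m : nat)
    (F : {set 'I_n * 'I_m}) (w u : 'I_n + 'I_m -> R) :
  (forall v, u v != 0) -> (forall v, w v != 0) ->
  (forall i j, (i, j) \in F ->
     w (inl i) / w (inr j) = u (inl i) / u (inr j)) ->
  forall i j, connect (bipartite_rel F) (inl i) (inr j) ->
     w (inl i) / w (inr j) = u (inl i) / u (inr j).
Proof.
move=> u0 w0 wu.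
have ratio v v' : (w v / w v' = u v / u v') <-> (w v / u v = w v' / u v').
  split=> /eqP; rewrite eqr_div // => /eqP E; apply/eqP; rewrite eqr_div //;
    by rewrite E mulrC.
move=> i j cij; apply/ratio.
have cS := sym_connect_sym (@bipartite_rel_sym _ _ F).
pose a := [pred v | w (inl i) / u (inl i) == w v / u v].
have cl : fingraph.closed (bipartite_rel F) a.
  apply: (intro_closed cS) => -[i1|j1] [i2|j2] //= /wu /ratio; rewrite !inE.
    by move=> <-.
  by move=> ->.
by apply/eqP; have := closed_connect cl cij; rewrite !inE eqxx => <-.
Qed.

(** * The orbit as a graph over the forest entries *)

Definition torus_orbit (R : realType) (n m : nat) (Y : 'M[R]_(n, m)) :
    set 'M[R]_(n, m) :=
  [set X | exists (a : 'I_n -> R) (b : 'I_m -> R),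
     [/\ forall i, a i != 0, forall j, b j != 0
       & forall i j, X i j = a i * Y i j * b j]].

(** The scalars and the forest potential solve the same equations on the edges of [F], so they have
    the same ratios between vertices joined in [F]; since [F] spans, this covers every nonzero entry
    of [Y]. *)
Lemma torus_orbit_graph (R : realType) (n m : nat) (Y : 'M[R]_(n, m))
    (F : {set 'I_n * 'I_m}) :
  F \subset (~: zero_entries Y)%SET -> forest F ->
  connect (bipartite_rel F) =2 connect (bipartite_rel (~: zero_entries Y)%SET) ->
  torus_orbit Y =
  [set X | (forall e, e \in F -> X e.1 e.2 != 0) /\
     (forall e, e \notin F ->
        X e.1 e.2 = forest_extension Y F (fun f => X f.1 f.2) e)].
Proof.
move=> /fintype.subsetP FE fF cFE.
have YF f : f \in F -> Y f.1 f.2 != 0 by move/FE; rewrite !inE.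
apply/seteqP; split=> X /=; last first.
  move=> [X0 XE]; pose w := forest_potential Y F (fun f => X f.1 f.2).
  have w0 v : w v != 0 by apply: forest_potential_neq0.
  (* The potential supplies the row scalars, its inverse the column scalars. *)
  exists (fun i => w (inl i)), (fun j => (w (inr j))^-1); split=> //.
    by move=> j; rewrite invr_eq0.
  move=> i j; rewrite [_ * Y i j]mulrC -mulrA.
  have [Fij|/XE//] := boolP ((i, j) \in F).
  by rewrite -[RHS]/(forest_extension _ _ _ (i, j)) forest_extension_in.
move=> [a [b [a0 b0 XE]]].
have X0 e : e \in F -> X e.1 e.2 != 0.
  by move=> /YF Ye; rewrite XE !mulf_neq0.
split=> // -[i j] _ /=; rewrite /forest_extension /=.
(* Where [Y] vanishes both sides are zero; elsewhere the ends of [(i, j)] are joined in [F]. *)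
have [Yij|Yij] := eqVneq (Y i j) 0; first by rewrite XE Yij mulr0 !mul0r.
set w := forest_potential Y F _.
(* Inverting [b] turns the product [a i * b j] into a quotient of potentials. *)
pose u (v : 'I_n + 'I_m) := match v with inl i => a i | inr j => (b j)^-1 end.
have u0 v : u v != 0 by case: v => k //=; rewrite invr_eq0.
have w0 v : w v != 0 by apply: forest_potential_neq0.
rewrite (@potential_ratio_connect _ _ _ F w u) //=.
- by rewrite invrK XE mulrA [Y i j * _]mulrC.
- move=> i' j' Fij; rewrite /w (forest_potential_edge _ _ fF Fij) /= mulfK // XE invrK.
  by rewrite mulrAC mulfK // (YF _ Fij).
- by rewrite cFE; apply: connect1; rewrite /= !inE.
Qed.

Lemma torus_orbit_submanifold (R : realType) (n m : nat) (Y : 'M[R]_(n, m)) :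
  embedded_submanifold
    (n + m - num_components (~: zero_entries Y)%SET)%N (torus_orbit Y).
Proof.
have [F [FE fF cFE]] := spanning_forest (~: zero_entries Y)%SET.
(* As [num_components F + #|F| = n + m], the truncated subtraction gives exactly [#|F|]. *)
rewrite (torus_orbit_graph FE fF cFE) -(forest_num_components fF).
have -> : num_components (~: zero_entries Y)%SET = num_components F.
  by apply: eq_n_comp => u v; rewrite cFE.
rewrite addnC addnK; apply: graph_embedded_submanifold.
  by move=> x x'; exact: eq_forest_extension.
move=> p q k U g; apply: forest_extension_smooth => f /(fintype.subsetP FE).
by rewrite !inE.
Qed.

(** * Closures *)

(** Rescaling is multiplication on both sides by invertible diagonal matrices. *)
Lemma rank_torus_orbit (R : realType) (n m : nat) (Y X : 'M[R]_(n, m)) :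
  torus_orbit Y X -> \rank X = \rank Y.
Proof.
move=> [a [b [a0 b0 XE]]].
have diag_unit k (c : 'I_k -> R) : (forall i, c i != 0) ->
    diag_mx (\row_i c i) \in unitmx.
  move=> c0; rewrite unitmxE unitfE det_diag; apply/prodf_neq0 => i _.
  by rewrite mxE.
have -> : X = diag_mx (\row_i a i) *m Y *m diag_mx (\row_j b j).
  by apply/matrixP => i j; rewrite mul_mx_diag mxE mul_diag_mx !mxE XE.
rewrite mxrankMfree ?row_free_unit ?diag_unit //.
by rewrite eqmxMfull // row_full_unit diag_unit.
Qed.

Lemma continuous_det_mulmx (R : realType) (n m s : nat)
    (P : 'M[R]_(s, n)) (Q : 'M[R]_(m, s)) :
  continuous (fun X : 'M[R]_(n, m) => \det (P *m X *m Q)).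
Proof.
have CU : Ck_scalar 0 setT (fun X : 'M[R]_(n, m) => \det (P *m X *m Q)).
  apply: Ck_scalar_sum => sg; apply: Ck_scalarM; first exact: Ck_scalar_cst.
  apply: Ck_scalar_prod => i _.
  have -> : (fun X => (P *m X *m Q) i (sg i)) =
      fun X => \sum_j (\sum_k P i k * X k j) * Q j (sg i).
    by apply: funext => X; rewrite mxE; apply: eq_bigr => j _; rewrite mxE.
  apply: Ck_scalar_sum => j; apply: Ck_scalarM; last exact: Ck_scalar_cst.
  apply: Ck_scalar_sum => k; apply: Ck_scalarM; first exact: Ck_scalar_cst.
  exact: Ck_scalar_coord.
by move=> X; exact: (Ck_scalar_continuous CU I).
Qed.

(** [P] and [Q] are one-sided inverses of the two factors in a full-rank factorization of [X]. *)
Lemma mxrank_factor1 (R : fieldType) (n m : nat) (X : 'M[R]_(n, m)) :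
  exists (P : 'M[R]_(\rank X, n)) (Q : 'M[R]_(m, \rank X)), P *m X *m Q = 1%:M.
Proof.
have /row_fullP[P PX] := col_base_full X.
have /row_freeP[Q XQ] := row_base_free X.
exists P, Q; rewrite -[X in _ *m X *m _]mulmx_base.
by rewrite mulmxA PX mul1mx XQ.
Qed.

(** Lower semicontinuity of the rank: [\det (P *m Z *m Q)] is nonzero at [Z = X], hence at some
    nearby [Z] in [A], which forces [\rank X <= \rank Z]. *)
Lemma closure_rank_le (R : realType) (n m r : nat) (A : set 'M[R]_(n, m)) :
  A `<=` [set X | (\rank X <= r)%N] -> closure A `<=` [set X | (\rank X <= r)%N].
Proof.
move=> Ar X clX /=.
have [P [Q PXQ]] := mxrank_factor1 X.
have dX : \det (P *m X *m Q) != 0 by rewrite PXQ det1 oner_neq0.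
have near0 : nbhs X [set Z : 'M[R]_(n, m) | \det (P *m Z *m Q) != 0] :=
  @continuous_det_mulmx R n m _ P Q X _
    (open_nbhs_nbhs (conj (@open_neq R 0) dX)).
have [Z [AZ /= Z0]] := clX _ near0.
apply: leq_trans (Ar _ AZ).
have : P *m Z *m Q \in unitmx by rewrite unitmxE unitfE.
rewrite -row_free_unit => /eqP <-.
by apply: leq_trans (mxrankM_maxl _ _) (mxrankM_maxr _ _).
Qed.

Lemma closure_entry0 (R : realType) (n m : nat) (A : set 'M[R]_(n, m)) i j :
  (forall X, A X -> X i j = 0) -> forall X, closure A X -> X i j = 0.
Proof.
move=> A0 X clX; apply/eqP/negPn/negP => Xij.
have near0 : nbhs X [set Z : 'M[R]_(n, m) | Z i j != 0] :=
  @coord_continuous R n m i j X _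
    (open_nbhs_nbhs (conj (@open_neq R 0) Xij)).
by have [Z [/A0 Zij /=]] := clX _ near0; rewrite Zij eqxx.
Qed.

(** * Linear spaces of rescalings inside the closure *)

Lemma closure_line (R : realType) (n m : nat) (A : set 'M[R]_(n, m)) X Y :
  (forall e : R, e != 0 -> A (X + e *: Y)) -> closure A X.
Proof.
move=> Ae B BX.
have cX : (fun e : R => X + e *: Y) @ (0 : R) --> X.
  rewrite -[in X in _ --> X](addr0 X) -[in X in _ --> X](scale0r Y).
  by apply: cvgD; [exact: cvg_cst | apply: cvgZr_tmp; exact: cvg_id].
have : \forall e \near (0 : R)^', B (X + e *: Y) /\ e != 0.
  near=> e; split; last by near: e; exact: nbhs_dnbhs_neq.
  by near: e; apply: cvg_within; exact: cX.
move=> /filter_ex[e [Be e0]].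
by exists (X + e *: Y); split=> //; exact: Ae.
Unshelve. all: by end_near. Qed.

(* With [g i j = i] (resp. [g i j = j]) the space [V] consists of the row
   (resp. column) rescalings of [Y]. *)
Lemma rescaling_vspace (R : realType) (n m : nat) (T : finType)
    (g : 'I_n -> 'I_m -> T) (Y : 'M[R]_(n, m)) :
  exists V : {vspace 'M[R]_(n, m)},
    [/\ Y \in V,
        forall X, X \in V -> exists d : T -> R,
          forall i j, X i j = d (g i j) * Y i j
      & \dim V = #|[pred k | [exists i, exists j, (g i j == k) && (Y i j != 0)]]|].
Proof.
set K := [pred k | _].
(* The pieces with key in [K] are nonzero, have disjoint supports and sum to [Y]. *)
pose piece k : 'M[R]_(n, m) := \matrix_(i, j) (if g i j == k then Y i j else 0).
pose b := [tuple piece (enum_val l) | l < #|K|].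
have bE (l : 'I_#|K|) : b`_l = piece (enum_val l).
  exact: (nth_mktuple (fun l => piece (enum_val l))).
exists <<b>>%VS; split.
- have -> : Y = \sum_(l < #|K|) b`_l.
    apply/matrixP => i j; rewrite summxE.
    under eq_bigr do rewrite bE mxE.
    have [Yij|Yij] := eqVneq (Y i j) 0.
      by rewrite big1 // => l _; rewrite Yij if_same.
    have Kg : g i j \in K.
      by apply/existsP; exists i; apply/existsP; exists j; rewrite eqxx.
    rewrite (bigD1 (enum_rank_in Kg (g i j))) //= enum_rankK_in // eqxx.
    rewrite big1 ?addr0 // => l ne; case: eqP => // gl; case/eqP: ne.
    by apply: enum_val_inj; rewrite enum_rankK_in.
  by apply: memv_suml => l _; apply/memv_span/mem_nth; rewrite size_tuple.
- move=> X /coord_span ->.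
  exists (fun k => \sum_(l < #|K|) coord b l X * (enum_val l == k)%:R).
  move=> i j; rewrite summxE big_distrl; apply: eq_bigr => l _ /=.
  rewrite mxE bE mxE eq_sym -mulrA; case: eqP => _; first by rewrite mul1r.
  by rewrite mul0r.
- suff /eqP -> : free b by rewrite size_tuple.
  apply/freeP => c /matrixP c0 l.
  (* At a nonzero entry of the piece [l] all other pieces vanish, which isolates the coefficient
     [c l]. *)
  have /existsP[i /existsP[j /andP[/eqP gk Yij]]] := enum_valP l.
  move: (c0 i j); rewrite summxE (bigD1 l) //= big1 ?addr0 => [|l' ne].
    by rewrite mxE bE !mxE gk eqxx => /eqP; rewrite mulf_eq0 (negbTE Yij) orbF => /eqP.
  rewrite mxE bE mxE gk; case: eqP => [/enum_val_inj ll|]; last by rewrite mulr0.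
  by rewrite ll eqxx in ne.
Qed.

(** Replacing the zero scalars by a common [e != 0] gives points of [A] that tend to [X] as [e]
    tends to 0. *)
Lemma rescaling_closure (R : realType) (n m : nat) (T : finType)
    (g : 'I_n -> 'I_m -> T) (Y : 'M[R]_(n, m)) (A : set 'M[R]_(n, m)) :
  (forall d : T -> R, (forall k, d k != 0) ->
     A (\matrix_(i, j) (d (g i j) * Y i j))) ->
  forall (X : 'M[R]_(n, m)) (d : T -> R),
    (forall i j, X i j = d (g i j) * Y i j) -> closure A X.
Proof.
move=> AY X d XE.
apply: (@closure_line _ _ _ _ _ (\matrix_(i, j) ((d (g i j) == 0)%:R * Y i j))).
move=> e e0.
have -> : X + e *: (\matrix_(i, j) ((d (g i j) == 0)%:R * Y i j)) =
    \matrix_(i, j) ((d (g i j) + e * (d (g i j) == 0)%:R) * Y i j).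
  by apply/matrixP => i j; rewrite !mxE XE mulrDl mulrA.
apply: (AY (fun k => d k + e * (d k == 0)%:R)) => k.
by have [->|dk] := eqVneq (d k) 0; rewrite ?add0r ?mulr1 // mulr0 addr0.
Qed.

(** Column rescalings account for the nonzero columns, row rescalings for the nonzero rows; [V] is
    chosen according to the larger count. *)
Lemma vspace_in_closure_torus_orbit (R : realType) (n m : nat)
    (Y : 'M[R]_(n, m)) :
  exists V : {vspace 'M[R]_(n, m)},
    [/\ Y \in V, [set X | X \in V] `<=` closure (torus_orbit Y)
      & (maxn (num_nonzero_rows Y) (num_nonzero_cols Y) <= \dim V)%N].
Proof.
have [le_ab|/ltnW le_ba] := leqP (num_nonzero_rows Y) (num_nonzero_cols Y).
  have [V [YV VP dV]] := rescaling_vspace (fun _ j => j) Y.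
  exists V; split=> //.
    move=> X /VP[d]; apply: rescaling_closure => {}d d0.
    exists (fun=> 1), d; split=> // i j; by rewrite mxE mul1r mulrC.
  rewrite dV subset_leq_card //; apply/fintype.subsetP => j; rewrite !inE => cj.
  have /existsP[i Yij] : [exists i, Y i j != 0].
    apply: contraNT cj => /existsPn Y0.
    by apply/eqP/colP => i; rewrite !mxE; apply/eqP/negPn.
  by apply/existsP; exists i; apply/existsP; exists j; rewrite eqxx.
have [V [YV VP dV]] := rescaling_vspace (fun i _ => i) Y.
exists V; split=> //.
  move=> X /VP[d]; apply: rescaling_closure => {}d d0.
  exists d, (fun=> 1); split=> // i j; by rewrite mxE mulr1.
rewrite dV subset_leq_card //; apply/fintype.subsetP => i; rewrite !inE => ri.
have /existsP[j Yij] : [exists j, Y i j != 0].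
  apply: contraNT ri => /existsPn Y0.
  by apply/eqP/rowP => j; rewrite !mxE; apply/eqP/negPn.
by apply/existsP; exists i; apply/existsP; exists j; rewrite eqxx.
Qed.

Theorem lemma3p6 (R : realType) (n m : nat) (le_nm : (n <= m)%N)
    (Xbar : 'M[R]_(n, m)) :
  let r := \rank Xbar in
  let Ibar := zero_entries Xbar in
  let c := num_components (~: Ibar)%SET in
  let alpha := num_nonzero_rows Xbar in
  let beta := num_nonzero_cols Xbar in
  exists M : set 'M[R]_(n, m),
    [/\ embedded_submanifold (n + m - c)%N M,
        M Xbar,
        M `<=` [set X | \rank X = r /\
                        forall i j, (i, j) \in Ibar -> X i j = 0]
      & exists V : {vspace 'M[R]_(n, m)},
          [/\ Xbar \in V,
              [set X | X \in V] `<=` closure M,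
              closure M `<=` [set X | (\rank X <= r)%N /\
                        forall i j, (i, j) \in Ibar -> X i j = 0]
            & (maxn alpha beta <= \dim V)%N]].
Proof.
move=> r Ibar c alpha beta; exists (torus_orbit Xbar).
have orbit0 X i j : (i, j) \in Ibar -> torus_orbit Xbar X -> X i j = 0.
  rewrite inE /= => /eqP Y0 [a [b [_ _ ->]]].
  by rewrite Y0 mulr0 mul0r.
split; first exact: torus_orbit_submanifold.
- exists (fun=> 1), (fun=> 1); split=> *; rewrite ?oner_neq0 //.
  by rewrite mul1r mulr1.
- move=> X MX; split; first exact: rank_torus_orbit.
  by move=> i j Iij; exact: orbit0 MX.
have [V [YV Vcl dV]] := vspace_in_closure_torus_orbit Xbar.
(* Rank at most [r] and the vanishing of an entry are closed conditions that hold on the orbit. *)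
exists V; split=> // X clX; split.
  apply: closure_rank_le clX => Z MZ /=.
  by rewrite (rank_torus_orbit MZ).
by move=> i j Iij; apply: closure_entry0 clX => Z; exact: orbit0.
Qed.
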